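(* Let $p>2$ and, for each $d\ge1$, let $U_p(x)=p^{-1}\|x\|^p$ for $x\in\mathbf{R}^d$. Then for every $x\in\mathbf{R}^d$, $$\|\nabla^2U_p(x)\|_{\mathrm{op}}=(p-1)\,\|\nabla U_p(x)\|^{(p-2)/(p-1)}.$$ Let $G(s)=(p-1)\,s^{(p-2)/(p-1)}$ for $s\ge0$, and fix $c>1$. Then there exists $\eta_0>0$, depending only on $p$ and $c$, such that for every $0<\eta\le\eta_0$ and every $d\ge1$, the proposal scale $\sigma=\sigma_d=\eta\,\left((p-1)\,d\right)^{-(p-1)/p}$ satisfies $\mathcal{K}^{(c)}_{d,\sigma_d}(G)\le1/4$. In particular, for each such $\eta$, the worst-case acceptance probability is bounded away from zero uniformly in state and dimension: $\inf_{d\ge1}\underline{\alpha}_{\sigma_d}>0$, where $\underline{\alpha}_{\sigma_d}$ is computed for the potential $U_p$ on $\mathbf{R}^d$.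
   Context: $\|\cdot\|$ is the Euclidean norm and $\|\cdot\|_{\mathrm{op}}$ the corresponding operator norm. $a_+=\max\{a,0\}$. For a continuous nondecreasing $G\colon[0,\infty)\to[0,\infty)$ and $r,s\ge0$, $\Gamma(r,s)$ is the value at time $r$ of the maximal (i.e. pointwise largest) nonnegative solution of $\dot\gamma=G(\gamma)$, $\gamma(0)=s$. Set $\overline{G}(r,s)=2\int_0^1(1-t)\,G(\Gamma(t\,r,s))\,\mathrm{d}t$ and, for $r,\sigma>0$, $\mathcal{K}_{r,\sigma}(G)=\frac{r^2}{2}\,\sup\left\{\frac{\overline{G}(r,s)}{1+\sigma\,s}:s\ge0\right\}$. For $c>1$, $d\ge 1$, $\sigma>0$, $\mathcal{K}^{(c)}_{d,\sigma}(G)$ denotes $\mathcal{K}_{r,\sigma}(G)$ with $r=\sigma\,(c\,d)^{1/2}$. Acceptance probabilities (Gaussian random-walk Metropolis with target density proportional to $\exp(-U)$ on $\mathbf{R}^d$): with $Z\sim\mathcal{N}(0,\mathbf{I}_d)$, $\alpha_\sigma(x)=\mathbf{E}\left(\exp\left(-[U(x+\sigma Z)-U(x)]_+\right)\right)$ and $\underline{\alpha}_\sigma=\inf_{x\in\mathbf{R}^d}\alpha_\sigma(x)$. *)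

(* Defs.v *)
From HB Require Import structures.
From mathcomp Require Import all_boot all_order all_algebra.
From mathcomp Require Import all_classical all_reals all_analysis.
Import Order.TTheory GRing.Theory Num.Theory.
Import numFieldNormedType.Exports.

Set Implicit Arguments.
Unset Strict Implicit.
Unset Printing Implicit Defensive.

Local Open Scope classical_set_scope.
Local Open Scope ring_scope.

(* The norm `|x| of 'rV[R]_d is the sup norm, hence a separate definition; both
   norms induce the same topology, so the library's derivatives apply as is. *)
Definition enorm (R : realType) (d : nat) (x : 'rV[R]_d) : R :=
  Num.sqrt (\sum_(i < d) x ord0 i ^+ 2).

(* Matrices act on row vectors from the right, as the Jacobian 'J does. *)
Definition opnorm (R : realType) (d : nat) (A : 'M[R]_d) : R :=
  sup [set enorm (v *m A) | v in [set v : 'rV[R]_d | enorm v <= 1]].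

Definition gradient (R : realType) (d : nat) (U : 'rV[R]_d -> R)
    (x : 'rV[R]_d) : 'rV[R]_d :=
  \row_(i < d) 'D_(delta_mx ord0 i) U x.

Definition hessian (R : realType) (d : nat) (U : 'rV[R]_d -> R)
    (x : 'rV[R]_d) : 'M[R]_d :=
  'J (gradient U) x.

(* Nonnegative solutions on [0, r] of gamma' = G(gamma), gamma(0) = s.  For G
   continuous, the one-sided derivatives at 0 and r then exist and satisfy the
   equation as well. *)
Definition ode_solution (R : realType) (G : R -> R) (s r : R)
    (gamma : R -> R) : Prop :=
  [/\ gamma 0 = s,
      {in `[0, r], forall t, 0 <= gamma t},
      {within `[0, r], continuous gamma} &
      {in `]0, r[, forall t, is_derive t (1 : R) gamma (G (gamma t))}].

Definition maximal_ode_solution (R : realType) (G : R -> R) (s r : R)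
    (gamma : R -> R) : Prop :=
  ode_solution G s r gamma /\
  forall delta, ode_solution G s r delta ->
    {in `[0, r], forall t, delta t <= gamma t}.

(* Two maximal solutions on [0, r] agree on [0, r], so the set below is empty or
   a singleton.  It is empty exactly when the maximal solution blows up at or
   before time r, and the infimum is then +oo, the usual convention. *)
Definition Gamma (R : realType) (G : R -> R) (r s : R) : \bar R :=
  ereal_inf [set (gamma r)%:E | gamma in maximal_ode_solution G s r].

(* er_map G sends +oo to +oo, which is lim G at infinity whenever blow-up occurs:
   a bounded G has only global solutions. *)
Definition Gbar (R : realType) (G : R -> R) (r s : R) : \bar R :=
  (2%:E * \int[lebesgue_measure]_(t in `[0%R, 1%R])
            ((1 - t)%:E * er_map G (Gamma G (t * r) s)))%E.

Definition calK (R : realType) (r sigma : R) (G : R -> R) : \bar R :=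
  ((r ^+ 2 / 2)%:E *
   ereal_sup [set Gbar G r s * ((1 + sigma * s)^-1)%:E
             | s in [set s : R | (0 <= s)%R]])%E.

Definition calKc (R : realType) (c : R) (d : nat) (sigma : R)
    (G : R -> R) : \bar R :=
  calK (sigma * Num.sqrt (c * d%:R)) sigma G.

Definition tcons (R : realType) (d : nat) (z : measurableTypeR R * d.-tuple R) :
    d.+1.-tuple R :=
  [tuple of z.1 :: z.2].

Lemma measurable_tcons (R : realType) (d : nat) :
  measurable_fun [set: measurableTypeR R * d.-tuple R] (@tcons R d).
Proof. exact: measurable_cons. Qed.

HB.instance Definition _ (R : realType) (d : nat) :=
  @isMeasurableFun.Build _ _ _ _ (@tcons R d) (@measurable_tcons R d).

(* The law N(0, I_d), i.e. the d-fold product of the real standard normal law;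
   the library has binary products of measures and a product sigma-algebra on
   tuples, but no d-fold product measure. *)
Fixpoint std_normal (R : realType) (d : nat) : probability (d.-tuple R) R :=
  match d with
  | 0 => \d_([tuple])
  | d'.+1 => distribution
      (product_measure1 (normal_prob (0 : R) 1) (std_normal R d')) (@tcons R d')
  end.

(* The sample z of N(0, I_d) is a tuple, converted to a row vector. *)
Definition alpha (R : realType) (d : nat) (U : 'rV[R]_d -> R) (sigma : R)
    (x : 'rV[R]_d) : \bar R :=
  ('E_(std_normal R d)[(fun z : d.-tuple R =>
     expR (- Num.max (U (x + sigma *: \row_(i < d) tnth z i) - U x) 0))%R])%E.

Definition alpha_inf (R : realType) (d : nat) (U : 'rV[R]_d -> R)
    (sigma : R) : \bar R :=
  ereal_inf (range (alpha U sigma)).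

Definition Upow (R : realType) (p : R) (d : nat) (x : 'rV[R]_d) : R :=
  p^-1 * enorm x `^ p.

Definition Gpow (R : realType) (p : R) (s : R) : R :=
  (p - 1) * s `^ ((p - 2) / (p - 1)).

Definition sigma_scale (R : realType) (p eta : R) (d : nat) : R :=
  eta * ((p - 1) * d%:R) `^ (- ((p - 1) / p)).

(* Main.v *)
Require Import Defs.
From HB Require Import structures.
From mathcomp Require Import all_boot all_order all_algebra.
From mathcomp Require Import all_classical all_reals all_analysis.
From mathcomp Require Import measurable_realfun.
From mathcomp Require Import ring lra.
Import Order.TTheory GRing.Theory Num.Theory.
Import numFieldNormedType.Exports.

Set Implicit Arguments.
Unset Strict Implicit.
Unset Printing Implicit Defensive.

Local Open Scope classical_set_scope.
Local Open Scope ring_scope.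

(** Along the flow of gamma' = (p - 1) gamma^((p-2)/(p-1)) the quantity
    gamma^(1/(p-1)) grows at unit speed, so Gamma is explicit; in the variable
    y = s^(1/(p-1)) / ((p - 1) d)^(1/p) the supremum in K is then bounded
    independently of d.

    The acceptance bound needs neither concentration of |Z|^2 nor smallness of
    eta.  If <x, Z> <= - y0 |x| and |Z|^2 <= b d, then U decreases when
    |x| > sigma b d / (2 y0), and otherwise it increases by at most a constant
    times sigma^p d^(p-1) <= eta^p.  A linear combination of exponentials of
    linear forms in Z that is at most 1, positive only on this event, and of mean
    bounded below turns this into a bound on the expectation using nothing but the
    moment generating function of N(0, I_d). *)

(** * Gaussian exponential moments *)

(** The Radon-Nikodym derivative of the law agrees almost everywhere with the density, because both
    integrate to the law of every measurable set. Change of variables does the rest. *)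
Lemma ge0_integral_normal_prob (R : realType) (m s : R) (f : R -> \bar R) :
  measurable_fun setT f -> (forall x, 0 <= f x)%E ->
  (\int[normal_prob m s]_x f x =
   \int[lebesgue_measure]_x (f x * (normal_pdf m s x)%:E))%E.
Proof.
move=> mf f0.
have dom := normal_prob_dominates m s.
rewrite -(Radon_Nikodym_SigmaFinite.change_of_variables dom)//.
have mpdf : measurable_fun setT (fun x : R => (normal_pdf m s x)%:E).
  by apply/measurable_EFinP; exact: measurable_normal_pdf.
have fint := Radon_Nikodym_SigmaFinite.f_integrable dom.
have mRN := measurable_int _ fint.
apply: ae_eq_integral => //.
- exact: emeasurable_funM.
- exact: emeasurable_funM.
- apply: ae_eqe_mul2l; apply: integral_ae_eq => //.
  move=> E _ mE.
  by rewrite -(Radon_Nikodym_SigmaFinite.f_integral dom).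
Qed.

(** Completing the square: exponential tilting by [a] recentres the standard normal density at
    [a]. *)
Lemma normal_pdf_shift (R : realType) (a x : R) :
  expR (a * x) * normal_pdf 0 1 x = expR (a ^+ 2 / 2) * normal_pdf a 1 x.
Proof.
rewrite !normal_pdfE ?oner_neq0//= mulrCA [RHS]mulrCA; congr (_ * _).
by rewrite /normal_fun -!expRD; congr expR; field.
Qed.

Lemma normal_mgf (R : realType) (a : R) :
  (\int[normal_prob (0 : R) 1]_x (expR (a * x))%:E = (expR (a ^+ 2 / 2))%:E)%E.
Proof.
rewrite ge0_integral_normal_prob//; last first.
  by apply/measurable_EFinP; apply: measurableT_comp.
under eq_integral do rewrite -EFinM normal_pdf_shift EFinM.
rewrite ge0_integralZl//.
- by rewrite integral_normal_pdf mule1.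
- by apply/measurable_EFinP; exact: measurable_normal_pdf.
- by move=> x _; rewrite lee_fin normal_pdf_ge0.
Qed.

Lemma measurable_dot_tuple (R : realType) (d : nat) (a : 'I_d -> R) :
  measurable_fun setT (fun z : d.-tuple R => \sum_(i < d) a i * tnth z i).
Proof.
apply: measurable_sum => i; apply: measurable_funM => //.
exact: measurable_tnth.
Qed.

Lemma measurable_expR_dot (R : realType) (d : nat) (a : 'I_d -> R) :
  measurable_fun setT
    (fun z : d.-tuple R => expR (\sum_(i < d) a i * tnth z i)).
Proof. by apply: measurableT_comp => //; exact: measurable_dot_tuple. Qed.

(** Induction on [d]: the exponential factors over the head coordinate and the tail, and Tonelli
    separates the two integrals. *)
Lemma std_normal_mgf (R : realType) (d : nat) (a : 'I_d -> R) :
  (\int[std_normal R d]_z (expR (\sum_(i < d) a i * tnth z i))%:E =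
   (expR ((\sum_(i < d) a i ^+ 2) / 2))%:E)%E.
Proof.
elim: d a => [|d IH] a /=.
  rewrite integral_dirac//.
    by rewrite diracE in_setT mul1e !big_ord0 mul0r.
  by apply/measurable_EFinP; exact: measurable_expR_dot.
have mf : measurable_fun setT
    (fun z : d.+1.-tuple R => (expR (\sum_(i < d.+1) a i * tnth z i))%:E).
  by apply/measurable_EFinP; exact: measurable_expR_dot.
rewrite ge0_integral_distribution//.
rewrite fubini_tonelli1//; [|exact: measurableT_comp|by move=> x /=; rewrite lee_fin].
rewrite /fubini_F /=.
have inner x : (\int[std_normal R d]_y
    (expR (\sum_(i < d.+1) a i * tnth (tcons (x, y)) i))%:E =
    (expR ((\sum_(i < d) a (lift ord0 i) ^+ 2) / 2))%:E *
    (expR (a ord0 * x))%:E)%E.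
  under eq_integral => y _.
    rewrite big_ord_recl tnth0 expRD EFinM.
    under eq_bigr do rewrite tnthS.
    over.
  rewrite /= ge0_integralZl//; last first.
    by apply/measurable_EFinP; exact: measurable_expR_dot.
  by rewrite (IH (fun i => a (lift ord0 i))) muleC.
rewrite (eq_integral _ _ (fun x _ => inner x)).
rewrite ge0_integralZl//; last by apply/measurable_EFinP; apply: measurableT_comp.
rewrite normal_mgf -EFinM -expRD.
by congr (expR _)%:E; rewrite big_ord_recl; field.
Qed.

(** Integrability travels with the value, so that means of linear combinations with negative
    coefficients, such as the test function of [gaussian_test], can be computed term by term. *)
Definition has_mean (R : realType) (d : nat) (f : d.-tuple R -> R) (m : R) :=
  (std_normal R d).-integrable setT (EFin \o f) /\
  (\int[std_normal R d]_z (f z)%:E = m%:E)%E.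

Section has_mean.
Context {R : realType} {d : nat}.
Implicit Types (f g : d.-tuple R -> R) (m n k : R).

Lemma has_mean_cst k : has_mean (fun _ : d.-tuple R => k) k.
Proof.
split; first exact: finite_measure_integrable_cst.
rewrite integral_cst//= [X in (_ * X)%E](probability_setT (std_normal R d)).
by rewrite mule1.
Qed.

Lemma has_meanD f g m n :
  has_mean f m -> has_mean g n -> has_mean (fun z => f z + g z) (m + n).
Proof.
move=> [fi fm] [gi gn]; split; first exact: (integrableD measurableT fi gi).
by rewrite integralD_EFin// fm gn.
Qed.

Lemma has_meanZ k f m : has_mean f m -> has_mean (fun z => k * f z) (k * m).
Proof.
move=> [fi fm]; split; first exact: (integrableZl measurableT k fi).
under eq_integral do rewrite EFinM.
by rewrite integralZl// fm.
Qed.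

Lemma has_mean_sum (n : nat) (f : 'I_n -> d.-tuple R -> R) (m : 'I_n -> R) :
  (forall i, has_mean (f i) (m i)) ->
  has_mean (fun z => \sum_(i < n) f i z) (\sum_(i < n) m i).
Proof.
elim: n f m => [|n IH] f m fm.
  under eq_fun do rewrite big_ord0.
  by rewrite big_ord0; exact: has_mean_cst.
under eq_fun do rewrite big_ord_recl.
rewrite big_ord_recl; apply: has_meanD => //.
by apply: IH => i; exact: fm.
Qed.

Lemma has_mean_expR_dot (a : 'I_d -> R) :
  has_mean (fun z => expR (\sum_(i < d) a i * tnth z i))
    (expR ((\sum_(i < d) a i ^+ 2) / 2)).
Proof.
have mgf := std_normal_mgf a; split=> //.
apply/integrableP; split.
  by apply/measurable_EFinP; exact: measurable_expR_dot.
under eq_integral => z _ do rewrite gee0_abs ?lee_fin ?expR_ge0//.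
by rewrite mgf ltry.
Qed.

Lemma has_mean_expR_coord (i : 'I_d) (k : R) :
  has_mean (fun z => expR (k * tnth z i)) (expR (k ^+ 2 / 2)).
Proof.
have := has_mean_expR_dot (fun j => if j == i then k else 0).
under eq_fun => z.
  rewrite (bigD1 i)//= eqxx big1 ?addr0; last first.
    by move=> j /negbTE ->; rewrite mul0r.
  over.
rewrite (bigD1 i)//= eqxx big1 ?addr0// => j /negbTE ->.
by rewrite expr0n.
Qed.

Lemma has_mean_le f m (g : d.-tuple R -> R) :
  has_mean f m -> measurable_fun setT g -> (forall z, 0 <= g z <= 1) ->
  (forall z, f z <= g z) -> (m%:E <= \int[std_normal R d]_z (g z)%:E)%E.
Proof.
move=> [fi <-] mg g01 fg; apply: le_integral => //; last first.
  by move=> z _; rewrite lee_fin.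
apply: (@le_integrable _ _ _ _ _ _ _ (EFin \o (fun=> 1))) => //.
- exact/measurable_EFinP.
- move=> z _ /=; have /andP[g0 g1] := g01 z.
  by rewrite lee_fin !ger0_norm.
- exact: finite_measure_integrable_cst.
Qed.

End has_mean.

(** The quadratic Taylor term bounds y^2 / 2 by exp y for y >= 0. This replaces |Z|^2 by
    exponentials whose mean is known. *)
Lemma sqr_le_expR (R : realType) (x : R) : x ^+ 2 <= 2 * (expR x + expR (- x)).
Proof.
have pos (y : R) : 0 <= y -> y ^+ 2 <= 2 * expR y.
  by move=> /(expR_ge1Dxn 1); rewrite (_ : 2`! = 2)%N//; lra.
have e1 := expR_ge0 x; have e2 := expR_ge0 (- x).
have [x0|x0] := lerP 0 x; first by have := pos x x0; lra.
by have := pos (- x); rewrite sqrrN => /(_ _); lra.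
Qed.

(* The quadratic q(w) = a (w - w0) (w1 - w) in w = exp (- <e, Z>) is at most 1, is
   negative unless <e, Z> <= - y0, and has positive mean as soon as w1 is large
   because E w = exp (1 / 2) > w0.  The sum of exponentials dominates |Z|^2. *)
Lemma gaussian_test (R : realType) :
  exists y0 b delta : R, [/\ 0 < y0, 0 < b, 0 < delta &
    forall (d : nat) (e : 'I_d -> R), (1 <= d)%N -> \sum_(i < d) e i ^+ 2 = 1 ->
    exists h : d.-tuple R -> R, exists m : R, [/\ has_mean h m, delta <= m,
      forall z, h z <= 1 &
      forall z, 0 < h z -> \sum_(i < d) e i * tnth z i <= - y0 /\
        \sum_(i < d) tnth z i ^+ 2 <= b * d%:R]].
Proof.
(* [w0] is the value of w at <e, Z> = - 1/4, and [Ew] is the mean of w. [w1] is chosen so that w1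
   (Ew - w0) = exp 2 = E w^2; the mean of (w - w0) (w1 - w) then collapses to w0 Ew. *)
pose w0 : R := expR (1 / 4); pose Ew : R := expR (1 / 2).
pose w1 : R := expR 2 / (Ew - w0).
have w00 : 0 < w0 by exact: expR_gt0.
have Ew0 : 0 < Ew by exact: expR_gt0.
have w0Ew : 0 < Ew - w0 by rewrite subr_gt0 ltr_expR; lra.
have w01 : w0 < w1.
  rewrite ltr_pdivlMr// mulrBr -expRD.
  have : expR (1 / 4 + 1 / 2) < expR 2 :> R by rewrite ltr_expR; lra.
  by have := mulr_gt0 w00 w00; lra.
have w1E : w1 * (Ew - w0) = expR 2 by rewrite divfK// gt_eqF.
(* This factor makes the maximum of the quadratic, attained midway between [w0] and [w1], equal to
   1. *)
pose a := (2 / (w1 - w0)) ^+ 2.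
have a0 : 0 < a by rewrite exprn_gt0// divr_gt0// subr_gt0.
pose m := a * (w0 * Ew).
have m0 : 0 < m by apply: mulr_gt0 => //; exact: mulr_gt0.
(* With this [b] the penalty 2 S / (b d) below has mean m / 2, half the mean of the quadratic. *)
pose b := 8 * Ew / m.
have b0 : 0 < b by rewrite divr_gt0// mulr_gt0.
exists (1 / 4), b, (m / 2); split; [lra|exact: b0|lra|].
move=> d e d1 e1.
have d0 : 0 < d%:R :> R by rewrite ltr0n.
pose w (k : R) (z : d.-tuple R) := expR (\sum_(i < d) (k * e i) * tnth z i).
have wmean k : has_mean (w k) (expR (k ^+ 2 / 2)).
  have := has_mean_expR_dot (fun i => k * e i).
  under [\sum_(i < d) (k * e i) ^+ 2]eq_bigr do rewrite exprMn.
  by rewrite -mulr_sumr e1 mulr1.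
have wE k z : w k z = expR (k * \sum_(i < d) e i * tnth z i).
  by rewrite /w mulr_sumr; under eq_bigr do rewrite -mulrA.
pose S (z : d.-tuple R) :=
  \sum_(i < d) (expR (1 * tnth z i) + expR (-1 * tnth z i)).
have Smean : has_mean S (d%:R * (2 * Ew)).
  have -> : d%:R * (2 * Ew) = \sum_(i < d) (Ew + Ew).
    by rewrite sumr_const card_ord -[RHS]mulr_natl; ring.
  apply: has_mean_sum => i; rewrite /Ew; apply: has_meanD.
    by have := has_mean_expR_coord i (1 : R); rewrite expr1n.
  by have := has_mean_expR_coord i (-1 : R); rewrite sqrrN expr1n.
have zS z : \sum_(i < d) tnth z i ^+ 2 <= 2 * S z.
  rewrite mulr_sumr; apply: ler_sum => i _.
  by rewrite mul1r mulN1r sqr_le_expR.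
(* The quadratic minus 2 S / (b d), expanded into exponentials. If [h] is positive, so is the
   quadratic, which forces w > w0; and the penalty is below 1, which bounds |Z|^2 by b d. *)
pose h z := (a * (w0 + w1)) * w (-1) z + ((- a) * w (-2) z +
  (- (a * w0 * w1) + (- (2 / (b * d%:R))) * S z)).
have hE z : h z = a * (w (-1) z - w0) * (w1 - w (-1) z) - 2 * S z / (b * d%:R).
  have : w (-2) z = w (-1) z ^+ 2.
    by rewrite !wE expr2 -expRD; congr expR; ring.
  by rewrite /h => ->; ring.
have S0 z : 0 <= S z.
  by apply: sumr_ge0 => i _; rewrite addr_ge0 ?expR_ge0.
have Sbd0 z : 0 <= 2 * S z / (b * d%:R).
  by rewrite divr_ge0// mulr_ge0// ltW.
have q1 u : a * (u - w0) * (w1 - u) <= 1.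
  have -> : a * (u - w0) * (w1 - u) =
    1 - ((2 * u - w0 - w1) / (w1 - w0)) ^+ 2.
    by rewrite /a; field; lra.
  by rewrite gerBl sqr_ge0.
exists h, (m / 2); split.
- have -> : m / 2 = a * (w0 + w1) * Ew + ((- a) * expR 2 +
      (- (a * w0 * w1) + (- (2 / (b * d%:R))) * (d%:R * (2 * Ew)))).
    rewrite -w1E /b /m; field.
    by rewrite !gt_eqF.
  apply: has_meanD; first apply: has_meanZ.
    by have := wmean (-1); rewrite sqrrN expr1n.
  apply: has_meanD; first apply: has_meanZ.
    by have := wmean (-2); rewrite (_ : (-2) ^+ 2 / 2 = 2 :> R)//; field.
  by apply: has_meanD; [exact: has_mean_cst|exact: has_meanZ].
- by [].
- by move=> z; rewrite hE; have := Sbd0 z; have := q1 (w (-1) z); lra.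
- move=> z hz; have qz : 2 * S z / (b * d%:R) < a * (w (-1) z - w0) * (w1 - w (-1) z).
    by move: hz; rewrite hE subr_gt0.
  split.
    have : w0 < w (-1) z.
      rewrite ltNge; apply/negP => ww.
      have : a * (w (-1) z - w0) * (w1 - w (-1) z) <= 0.
        by rewrite mulr_le0_ge0 ?mulr_ge0_le0//; lra.
      by have := Sbd0 z; lra.
    by rewrite wE ltr_expR; lra.
  have : 2 * S z / (b * d%:R) <= 1 by have := q1 (w (-1) z); lra.
  rewrite ler_pdivrMr; last exact: mulr_gt0.
  by rewrite mul1r; exact: le_trans.
Qed.

(** * The Euclidean norm and increments of the potential *)

Definition dot (R : realType) (d : nat) (x y : 'rV[R]_d) : R :=
  \sum_(i < d) x ord0 i * y ord0 i.

Section euclidean.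
Context {R : realType} {d : nat}.
Implicit Types (x y v : 'rV[R]_d) (a : R).

Lemma dotC x y : dot x y = dot y x.
Proof. by apply: eq_bigr => i _; rewrite mulrC. Qed.

Lemma dotDr x y v : dot x (y + v) = dot x y + dot x v.
Proof.
by rewrite -big_split/=; apply: eq_bigr => i _; rewrite mxE mulrDr.
Qed.

Lemma dotZr a x y : dot x (a *: y) = a * dot x y.
Proof. by rewrite mulr_sumr; apply: eq_bigr => i _; rewrite mxE mulrCA. Qed.

Lemma dotDl x y v : dot (x + y) v = dot x v + dot y v.
Proof. by rewrite dotC dotDr !(dotC v). Qed.

Lemma dotZl a x y : dot (a *: x) y = a * dot x y.
Proof. by rewrite dotC dotZr (dotC y). Qed.

Lemma dot_ge0 x : 0 <= dot x x.
Proof. by apply: sumr_ge0 => i _; rewrite -expr2 sqr_ge0. Qed.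

Lemma dotE_enorm x : dot x x = \sum_(i < d) x ord0 i ^+ 2.
Proof. by apply: eq_bigr => i _; rewrite expr2. Qed.

Lemma enorm_ge0 x : 0 <= enorm x.
Proof. exact: sqrtr_ge0. Qed.

Lemma enorm_sqr x : enorm x ^+ 2 = dot x x.
Proof. by rewrite dotE_enorm sqr_sqrtr// -dotE_enorm dot_ge0. Qed.

Lemma enorm_eq0 x : (enorm x == 0) = (x == 0).
Proof.
apply/idP/eqP => [|->]; last first.
  rewrite /enorm big1 ?sqrtr0// => i _; by rewrite mxE expr0n.
rewrite -sqrf_eq0 enorm_sqr dotE_enorm psumr_eq0; last by move=> i _; exact: sqr_ge0.
move=> /allP x0; apply/rowP => i; rewrite mxE; apply/eqP.
by rewrite -sqrf_eq0; apply: x0; rewrite mem_index_enum.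
Qed.

Lemma enorm0 : enorm (0 : 'rV[R]_d) = 0.
Proof. by apply/eqP; rewrite enorm_eq0. Qed.

Lemma enorm_gt0 x : (0 < enorm x) = (x != 0).
Proof. by rewrite lt_def enorm_eq0 enorm_ge0 andbT. Qed.

Lemma enormZ a x : enorm (a *: x) = `|a| * enorm x.
Proof.
apply/eqP; rewrite -(eqrXn2 (n := 2)) ?mulr_ge0 ?enorm_ge0//.
by rewrite exprMn !enorm_sqr dotZr dotZl real_normK ?num_real// mulrA expr2.
Qed.

Lemma enorm_sqrD x y :
  enorm (x + y) ^+ 2 = enorm x ^+ 2 + 2 * dot x y + enorm y ^+ 2.
Proof. by rewrite !enorm_sqr dotDr !dotDl (dotC y x); ring. Qed.

(** Cauchy-Schwarz: the squared norm of <x, y> x - |x|^2 y is |x|^2 times the difference of the two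
    sides. *)
Lemma dot_sqr_le x y : dot x y ^+ 2 <= enorm x ^+ 2 * enorm y ^+ 2.
Proof.
have [->|x0] := eqVneq x 0.
  rewrite enorm0 expr0n mul0r /dot big1 ?expr0n// => i _.
  by rewrite mxE mul0r.
have xx : 0 < enorm x ^+ 2 by rewrite exprn_gt0// enorm_gt0.
have := sqr_ge0 (enorm (dot x y *: x + (- enorm x ^+ 2) *: y)).
rewrite enorm_sqrD !enormZ !exprMn dotZl dotZr !real_normK ?num_real//.
set c := dot x y; set X := enorm x ^+ 2; set Y := enorm y ^+ 2.
have -> : c ^+ 2 * X + 2 * (c * (- X * c)) + (- X) ^+ 2 * Y =
  X * (X * Y - c ^+ 2) by ring.
by rewrite pmulr_rge0// subr_ge0.
Qed.

(** Trades the square root for the polynomial [dot x x], from which measurability and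
    differentiability follow by composition. *)
Lemma powR_enorm x (a : R) : enorm x `^ a = dot x x `^ (a / 2).
Proof.
by rewrite -enorm_sqr -powR_mulrn ?enorm_ge0// -powRrM mulrCA divff ?mulr1.
Qed.

End euclidean.

(* Young's inequality with the conjugate exponents p / 2 and p / (p - 2). *)
Lemma powR_diff_le (R : realType) (p M N : R) : 2 < p -> 0 <= M -> 0 <= N ->
  p^-1 * N `^ p - p^-1 * M `^ p <= N `^ (p - 2) * (N ^+ 2 - M ^+ 2) / 2.
Proof.
move=> p2 M0 N0.
have p0 : p != 0 by lra.
have p20 : p - 2 != 0 by lra.
have := @conjugate_powR _ (M ^+ 2) (N `^ (p - 2)) (p / 2) (p / (p - 2)).
rewrite sqr_ge0 powR_ge0 => /(_ isT isT).
have -> : (0 < p / 2) by rewrite divr_gt0//; lra.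
have -> : (0 < p / (p - 2)) by rewrite divr_gt0//; lra.
have -> : (p / 2)^-1 + (p / (p - 2))^-1 = 1 by field; rewrite p20.
move=> /(_ isT isT erefl).
rewrite -powR_mulrn// -!powRrM.
have -> : 2%:R * (p / 2) = p by field.
have -> : (p - 2) * (p / (p - 2)) = p by field.
have -> : N `^ (p - 2) * (N ^+ 2 - M `^ 2%:R) / 2 =
   (N `^ p - M `^ 2%:R * N `^ (p - 2)) / 2.
  rewrite mulrBr [M `^ _ * _]mulrC; congr ((_ - _) / 2).
  rewrite -powR_mulrn// -powRD; first by congr (_ `^ _); ring.
  by apply/implyP => /eqP; lra.
set A := M `^ p; set B := N `^ p; set C := _ * _ => H.
have : C <= 2 / p * A + (p - 2) / p * B.
  apply: le_trans H _; rewrite le_eqVlt; apply/orP; left; apply/eqP.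
  by field; rewrite ?p20 ?p0.
have -> : (p - 2) / p = 1 - 2 * p^-1 by field.
nra.
Qed.

(** By [powR_diff_le] the sign of the increment is controlled by 2 <x, h> + |h|^2. For |x| >= L / (2
    t) the drift wins and this is nonpositive; for smaller |x| the drift is dropped and |x + h|^2 is
    at most (L / (2 t))^2 + L. *)
Lemma Upow_increment_le (R : realType) (p t L : R) (d : nat) (x h : 'rV[R]_d) :
  2 < p -> 0 < t -> dot x h <= - (t * enorm x) -> enorm h ^+ 2 <= L ->
  Num.max (Upow p (x + h) - Upow p x) 0 <=
    L / 2 * ((L / (2 * t)) ^+ 2 + L) `^ ((p - 2) / 2).
Proof.
move=> p2 t0 xh hL.
have M0 := enorm_ge0 x; have N0 := enorm_ge0 (x + h).
have L0 : 0 <= L by apply: le_trans hL; exact: sqr_ge0.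
rewrite ge_max; apply/andP; split; last first.
  by rewrite mulr_ge0 ?powR_ge0 ?divr_ge0.
rewrite /Upow; apply: (le_trans (powR_diff_le p2 M0 N0)).
have -> : enorm (x + h) ^+ 2 - enorm x ^+ 2 = 2 * dot x h + enorm h ^+ 2.
  by rewrite enorm_sqrD; ring.
have tM : 0 <= t * enorm x by rewrite mulr_ge0// ltW.
have [xbig|xsmall] := lerP (L / (2 * t)) (enorm x).
  apply: (@le_trans _ _ 0); last by rewrite mulr_ge0 ?powR_ge0 ?divr_ge0.
  rewrite mulr_le0_ge0// mulr_ge0_le0 ?powR_ge0//.
  by move: xbig; rewrite ler_pdivrMr ?mulr_gt0//; lra.
have N2 : enorm (x + h) ^+ 2 <= (L / (2 * t)) ^+ 2 + L.
  rewrite enorm_sqrD; suff : enorm x ^+ 2 <= (L / (2 * t)) ^+ 2 by lra.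
  by rewrite lerXn2r// ?nnegrE// ?ltW// (le_lt_trans M0 xsmall).
have NB : enorm (x + h) `^ (p - 2) <= ((L / (2 * t)) ^+ 2 + L) `^ ((p - 2) / 2).
  rewrite powR_enorm -enorm_sqr; apply: ge0_ler_powR => //.
  - by rewrite divr_ge0//; lra.
  - by rewrite nnegrE sqr_ge0.
  - by rewrite nnegrE (le_trans _ N2)// sqr_ge0.
rewrite -mulrA [leRHS]mulrC.
apply: (@le_trans _ _ (enorm (x + h) `^ (p - 2) * (L / 2))).
  by rewrite ler_wpM2l ?powR_ge0//; lra.
by rewrite ler_wpM2r// divr_ge0.
Qed.

(** * Dimension-free lower bound on the acceptance probability *)

Lemma measurable_acceptance (R : realType) (p s : R) (d : nat) (x : 'rV[R]_d) :
  measurable_fun setT (fun z : d.-tuple R =>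
    expR (- Num.max
      (Upow p (x + s *: \row_(i < d) tnth z i) - Upow p x) 0)).
Proof.
apply: measurableT_comp => //; apply: measurableT_comp => //.
apply: measurable_maxr => //; apply: measurable_funB => //.
rewrite /Upow; apply: measurable_funM => //.
under eq_fun do rewrite powR_enorm.
apply: (@measurableT_comp _ _ _ _ _ _ (fun u : R => u `^ (p / 2))); first exact: measurable_powR.
apply: measurable_sum => i.
have m : measurable_fun [set: d.-tuple R]
    (fun z => (x + s *: \row_(i < d) tnth z i) ord0 i).
  under eq_fun do rewrite !mxE.
  apply: measurable_funD => //; apply: measurable_funM => //.
  exact: measurable_tnth.
exact: measurable_funM.
Qed.

(** [gaussian_test] asks for a unit vector; at the origin any one will do, and d >= 1 supplies
    it. *)
Lemma unit_direction (R : realType) (d : nat) (x : 'rV[R]_d) : (1 <= d)%N ->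
  exists e : 'rV[R]_d, dot e e = 1 /\ x = enorm x *: e.
Proof.
case: d x => // d x _; have [->|x0] := eqVneq x 0.
  exists (delta_mx ord0 ord0); rewrite enorm0 scale0r; split=> //.
  rewrite /dot (bigD1 ord0)//= big1 ?mxE ?eqxx ?mulr1 ?addr0// => i /negbTE i0.
  by rewrite mxE i0 andbF mul0r.
exists ((enorm x)^-1 *: x); have ex : enorm x != 0 by rewrite enorm_eq0.
by rewrite dotZl dotZr -enorm_sqr scalerA mulfV// scale1r; split=> //; field.
Qed.

Lemma sigma_scale_gt0 (R : realType) (p eta : R) (d : nat) :
  2 < p -> 0 < eta -> (1 <= d)%N -> 0 < sigma_scale p eta d.
Proof.
move=> p2 eta0 d1; rewrite mulr_gt0// powR_gt0// mulr_gt0 ?ltr0n//; lra.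
Qed.

(** Since p - 1 >= 1, the scale is at most eta d^(-(p-1)/p), so sigma d <= eta d^(1/p). *)
Lemma sigma_scale_powR_le (R : realType) (p eta : R) (d : nat) :
  2 < p -> 0 < eta -> (1 <= d)%N ->
  (sigma_scale p eta d * d%:R) `^ p <= eta `^ p * d%:R.
Proof.
move=> p2 eta0 d1.
have p0 : p != 0 by lra.
have d0 : 0 < d%:R :> R by rewrite ltr0n.
have D0 : 0 < (p - 1) * d%:R by rewrite mulr_gt0//; lra.
set q := (p - 1) / p.
have q0 : 0 <= q by rewrite divr_ge0//; lra.
have dD : (d%:R : R) `^ q <= ((p - 1) * d%:R) `^ q.
  apply: ge0_ler_powR => //; [exact: ltW|exact: ltW|by nra].
have sd : sigma_scale p eta d * d%:R <= eta * d%:R `^ p^-1.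
  rewrite /sigma_scale -/q -mulrA ler_pM2l// powRN.
  apply: (@le_trans _ _ ((d%:R `^ q)^-1 * d%:R)).
    by rewrite ler_pM2r// lef_pV2 ?posrE ?powR_gt0.
  rewrite -powRN -[X in _ * X <= _](powRr1 (ltW d0)) -powRD; last first.
    by apply/implyP => _; rewrite gt_eqF.
  by rewrite (_ : - q + 1 = p^-1)// /q; field.
apply: (@le_trans _ _ ((eta * d%:R `^ p^-1) `^ p)).
  apply: ge0_ler_powR; rewrite ?nnegrE ?mulr_ge0 ?powR_ge0 ?(ltW eta0)//; lra.
by rewrite powRM ?powR_ge0 ?(ltW eta0)// -powRrM mulVf// powRr1// ltW.
Qed.

(** The bound of [Upow_increment_le] at t = s y0 and L = s^2 b d. As d <= d^2, the base of the power
    is at most a constant times (s d)^2, so the whole is at most a constant times (s d)^p / d, where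
    the dimension cancels. *)
Lemma increment_bound_le (R : realType) (p eta y0 b s L : R) (d : nat) :
  2 < p -> 0 < eta -> 0 < y0 -> 0 < b -> (1 <= d)%N ->
  s = sigma_scale p eta d -> L = s ^+ 2 * (b * d%:R) ->
  L / 2 * ((L / (2 * (s * y0))) ^+ 2 + L) `^ ((p - 2) / 2) <=
  b / 2 * ((b / (2 * y0)) ^+ 2 + b) `^ ((p - 2) / 2) * eta `^ p.
Proof.
move=> p2 eta0 y00 b0 d1 sE LE.
have s0 : 0 < s by rewrite sE; exact: sigma_scale_gt0.
have d0 : 0 < d%:R :> R by rewrite ltr0n.
have d1' : 1 <= d%:R :> R by rewrite ler1n.
have B0 : 0 <= (b / (2 * y0)) ^+ 2 + b by rewrite addr_ge0 ?sqr_ge0 ?ltW.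
have L0 : 0 <= L by rewrite LE mulr_ge0 ?sqr_ge0// mulr_ge0// ltW.
have sd0 : 0 <= s * d%:R by apply: mulr_ge0; exact: ltW.
have step : (L / (2 * (s * y0))) ^+ 2 + L <=
    (s * d%:R) ^+ 2 * ((b / (2 * y0)) ^+ 2 + b).
  have -> : (L / (2 * (s * y0))) ^+ 2 = (s * d%:R) ^+ 2 * (b / (2 * y0)) ^+ 2.
    by rewrite LE; field; rewrite !gt_eqF.
  rewrite [leRHS]mulrDr lerD2l LE exprMn -[leRHS]mulrA ler_wpM2l ?sqr_ge0//.
  by rewrite mulrC ler_pM2r//; nra.
apply: (@le_trans _ _ (L / 2 *
    ((s * d%:R) ^+ 2 * ((b / (2 * y0)) ^+ 2 + b)) `^ ((p - 2) / 2))).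
  rewrite ler_wpM2l ?divr_ge0//; apply: ge0_ler_powR => //.
  - by rewrite divr_ge0//; lra.
  - by rewrite nnegrE addr_ge0// sqr_ge0.
  - by rewrite nnegrE mulr_ge0// sqr_ge0.
rewrite powRM ?sqr_ge0// -(powR_mulrn _ sd0) -powRrM.
rewrite (_ : 2%:R * ((p - 2) / 2) = p - 2); last by field.
set B := _ `^ ((p - 2) / 2).
have -> : L / 2 * ((s * d%:R) `^ (p - 2) * B) =
    b / 2 * B * ((s * d%:R) ^+ 2 * (s * d%:R) `^ (p - 2) / d%:R).
  by rewrite LE; field; rewrite gt_eqF.
rewrite ler_wpM2l//; first by rewrite mulr_ge0 ?powR_ge0// divr_ge0 ?ltW.
rewrite -(powR_mulrn _ sd0) -powRD; last by apply/implyP => /eqP; lra.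
by rewrite subrKC ler_pdivrMr// sE; exact: sigma_scale_powR_le.
Qed.

(** The acceptance factor dominates exp (- K) h pointwise: where h <= 0 this is trivial, and where h
    > 0 the increment is at most K while h <= 1. Taking means gives a constant free of [d] and
    [x]. *)
Lemma alpha_Upow_ge (R : realType) (p eta : R) : 2 < p -> 0 < eta ->
  exists k : R, 0 < k /\ forall (d : nat) (x : 'rV[R]_d), (1 <= d)%N ->
    (k%:E <= alpha (@Upow R p d) (sigma_scale p eta d) x)%E.
Proof.
move=> p2 eta0; have [y0 [b [delta [y00 b0 delta0 test]]]] := gaussian_test R.
pose K := b / 2 * ((b / (2 * y0)) ^+ 2 + b) `^ ((p - 2) / 2) * eta `^ p.
exists (expR (- K) * delta); split; first by rewrite mulr_gt0 ?expR_gt0.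
move=> d x d1.
have s0 := sigma_scale_gt0 p2 eta0 d1; set s := sigma_scale p eta d in s0 *.
have [e [ee xe]] := unit_direction x d1.
have [|h [m [hm dm h1 hpos]]] := test d (fun i => e ord0 i) d1.
  by rewrite -ee; apply: eq_bigr => i _; rewrite expr2.
apply: (@le_trans _ _ (expR (- K) * m)%:E).
  by rewrite lee_fin ler_pM2l ?expR_gt0.
rewrite /alpha unlock; apply: has_mean_le (has_meanZ _ hm) _ _ _.
- exact: measurable_acceptance.
- move=> z; rewrite expR_ge0/= -[leRHS]expR0 ler_expR oppr_le0.
  by rewrite le_max lexx orbT.
- move=> z; have [hz|/hpos[ez zz]] := lerP (h z) 0.
    apply: (@le_trans _ _ 0); last exact: expR_ge0.
    by rewrite mulr_ge0_le0// expR_ge0.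
  apply: (@le_trans _ _ (expR (- K))).
    by rewrite ler_piMr ?expR_ge0.
  rewrite ler_expR lerN2; apply: le_trans _ (increment_bound_le p2 eta0 y00 b0 d1 erefl erefl).
  apply: Upow_increment_le => //; first by rewrite mulr_gt0.
    rewrite {1}xe dotZl dotZr.
    have -> : dot e (\row_i tnth z i) = \sum_(i < d) e ord0 i * tnth z i.
      by apply: eq_bigr => i _; rewrite mxE.
    have sx : 0 <= s * enorm x by apply: mulr_ge0; [exact: ltW|exact: enorm_ge0].
    by rewrite -/s; have := ler_wpM2l sx ez; nra.
  rewrite -/s enormZ exprMn real_normK ?num_real// ler_wpM2l ?sqr_ge0//.
  by rewrite enorm_sqr dotE_enorm; under eq_bigr do rewrite mxE.
Qed.

(** * The comparison equation *)

Lemma is_derive1_comp (R : realType) (f g : R -> R) (x df dg : R) :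
  is_derive x 1 f df -> is_derive (f x) 1 g dg ->
  is_derive x 1 (g \o f) (dg * df).
Proof.
move=> [fd fE] [gd gE]; split.
  by apply/derivable1_diffP/differentiable_comp; exact/derivable1_diffP.
by rewrite -derive1E derive1_comp// !derive1E fE gE.
Qed.

Lemma continuous_powR_gt0 (R : realType) (q x : R) : 0 < x ->
  {for x, continuous (fun u : R => u `^ q)}.
Proof.
move=> x0; apply: differentiable_continuous; apply/derivable1_diffP.
by apply: derivable_powR; rewrite in_itv/= x0.
Qed.

(** The absolute value matters at 0: [powR] takes the value 1 on negative bases, so the plain power
    has a jump there. *)
Lemma continuous_norm_powR (R : realType) (q : R) : 0 < q ->
  continuous (fun u : R => `|u| `^ q).
Proof.
move=> q0 x; have [->|x0] := eqVneq x 0.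
  apply/cvgrPdist_lt => e e0; rewrite normr0 powR0 ?gt_eqF//.
  have e'0 : 0 < e `^ q^-1 by rewrite powR_gt0.
  near=> u; rewrite sub0r normrN ger0_norm ?powR_ge0//.
  have ue : `|u| < e `^ q^-1.
    by near: u; have := @nbhs0_lt R R _ e'0.
  apply: lt_le_trans (_ : (e `^ q^-1) `^ q <= _).
    by apply: gt0_ltr_powR; rewrite ?nnegrE ?powR_ge0.
  by rewrite -powRrM mulVf ?gt_eqF// powRr1// ltW.
apply: (@continuous_comp _ _ _ (fun u : R => `|u|) (fun u : R => u `^ q)).
  exact: norm_continuous.
by apply: continuous_powR_gt0; rewrite normr_gt0.
Unshelve. all: by end_near. Qed.

(** [Gpow] is not Lipschitz at 0, and from s = 0 the constant 0 is also a solution; this formula is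
    the branch that leaves 0 at once. *)
Definition power_flow (R : realType) (p s t : R) : R :=
  (s `^ (p - 1)^-1 + t) `^ (p - 1).

Lemma power_flow_solution (R : realType) (p s r : R) :
  2 < p -> 0 <= s ->
  ode_solution (Gpow p) s r (power_flow p s).
Proof.
move=> p2 s0; have p10 : p - 1 != 0 by lra.
have sa0 := powR_ge0 s (p - 1)^-1.
split.
- by rewrite /power_flow addr0 -powRrM mulVf// powRr1.
- by move=> t _; exact: powR_ge0.
- have c : continuous (fun t => `|s `^ (p - 1)^-1 + t| `^ (p - 1)).
    move=> t; apply: (@continuous_comp _ _ _ (fun u => s `^ (p - 1)^-1 + u)
      (fun u : R => `|u| `^ (p - 1))).
      by apply: cvgD; [exact: cvg_cst|exact: cvg_id].
    by apply: continuous_norm_powR; lra.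
  apply: (@subspace_eq_continuous _ _ _ (fun t => `|s `^ (p - 1)^-1 + t| `^ (p - 1))).
    move=> t; rewrite inE/= in_itv/= => /andP[t0 _].
    by rewrite /power_flow ger0_norm// addr_ge0.
  exact: continuous_subspaceT.
- move=> t; rewrite in_itv/= => /andP[t0 _].
  have st0 : 0 < s `^ (p - 1)^-1 + t by rewrite ltr_wpDl.
  have -> : Gpow p (power_flow p s t) =
      ((p - 1) * (s `^ (p - 1)^-1 + t) `^ (p - 1 - 1)) * (0 + 1).
    rewrite /Gpow /power_flow -powRrM add0r mulr1.
    by congr (_ * _ `^ _); field.
  apply: (@is_derive1_comp _ (fun u => s `^ (p - 1)^-1 + u) (fun u => u `^ (p - 1))).
  by apply: is_derive1_powR.
Qed.

(* (gamma + eps)^a has derivative at most 1 along any solution gamma; eps > 0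
   avoids the points where gamma vanishes. *)
Lemma power_flow_maximal (R : realType) (p s r : R) (delta : R -> R) :
  2 < p -> 0 <= s ->
  ode_solution (Gpow p) s r delta ->
  {in `[0, r], forall t, delta t <= power_flow p s t}.
Proof.
move=> p2 s0 [d0 dge0 dc dd] t; rewrite in_itv/= => /andP[t0 tr].
have p10 : p - 1 != 0 by lra.
have a_gt0 : 0 < (p - 1)^-1 by rewrite invr_gt0; lra.
have dget x : x \in `[0, t] -> 0 <= delta x.
  rewrite in_itv/= => /andP[x0 xt]; apply: dge0.
  by rewrite in_itv/= x0 (le_trans xt).
have dt0 : 0 <= delta t by apply: dget; rewrite in_itv/= t0 lexx.
(* Mean value theorem on [0, t] for w = (delta + eps)^(1/(p-1)); the [+ 0] in [dw] is the derivative
   of the constant eps. *)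
have key eps : 0 < eps -> (delta t) `^ (p - 1)^-1 <= (s + eps) `^ (p - 1)^-1 + t.
  move=> e0.
  pose w x := (delta x + eps) `^ (p - 1)^-1.
  pose dw x := (p - 1)^-1 * (delta x + eps) `^ ((p - 1)^-1 - 1) * (Gpow p (delta x) + 0).
  have [|||c ct] := @MVT_segment R w dw 0 t.
  - by [].
  - move=> c0; rewrite in_itv/= => /andP[x0 xt].
    have := dd c0; rewrite in_itv/= x0 (lt_le_trans xt)// => /(_ isT) dc0.
    have pos : 0 < delta c0 + eps.
      by rewrite ltr_wpDl// dget// in_itv/= !ltW.
    apply: (@is_derive1_comp _ (fun u => delta u + eps) (fun u => u `^ (p - 1)^-1)).
    exact: is_derive1_powR.
  - apply/subspace_continuousP => x xt.
    have pos : 0 < delta x + eps by rewrite ltr_wpDl// dget.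
    apply: (@cvg_comp _ _ _ (fun u => delta u + eps) (fun u => u `^ (p - 1)^-1) _
      (nbhs (delta x + eps))); last exact: continuous_powR_gt0.
    apply: cvgD; last exact: cvg_cst.
    have sub : `[0, t] `<=` `[0, r].
      by apply: subset_itvl; rewrite bnd_simp.
    by move/(continuous_subspaceW sub)/subspace_continuousP : dc => /(_ x xt).
  rewrite /w d0 subr0 => wt.
  (* Replacing delta by delta + eps inside G only increases the product, and then the two exponents
     add up to 0. *)
  have dwle : dw c <= 1.
    rewrite /dw /Gpow addr0.
    have dc0 := dget c ct.
    have pos : 0 < delta c + eps by rewrite ltr_wpDl.
    rewrite mulrACA mulVf// mul1r.
    apply: (@le_trans _ _ ((delta c + eps) `^ ((p - 1)^-1 - 1) *
        (delta c + eps) `^ ((p - 2) / (p - 1)))).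
      rewrite ler_wpM2l ?powR_ge0//; apply: ge0_ler_powR.
      - by rewrite divr_ge0//; lra.
      - by [].
      - by rewrite nnegrE ltW.
      - by rewrite lerDl ltW.
    rewrite -powRD; last by apply/implyP => _; rewrite gt_eqF.
    by rewrite (_ : (p - 1)^-1 - 1 + (p - 2) / (p - 1) = 0) ?powRr0//; field.
  have : w t <= (s + eps) `^ (p - 1)^-1 + t.
    have : dw c * t <= t by rewrite ler_piMl.
    by move: wt; rewrite /w; lra.
  apply: le_trans; apply: ge0_ler_powR; rewrite ?nnegrE ?(ltW a_gt0)//.
    by rewrite addr_ge0// ltW.
  by rewrite lerDl ltW.
(* To let eps tend to 0, move t to the left and raise to the power p - 1: the right side becomes s +
   eps, affine in eps. *)
have ka : delta t `^ (p - 1)^-1 <= s `^ (p - 1)^-1 + t.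
  have [q0|q0] := lerP (delta t `^ (p - 1)^-1 - t) 0; first by have := powR_ge0 s (p - 1)^-1; lra.
  suff : (delta t `^ (p - 1)^-1 - t) `^ (p - 1) <= s.
    move=> /(ge0_ler_powR (ltW a_gt0) _ _) => /(_ (powR_ge0 _ _) s0).
    by rewrite -powRrM mulfV// powRr1 ?(ltW q0)//; lra.
  apply/ler_addgt0Pr => eps e0.
  have se0 : 0 <= s + eps by rewrite addr_ge0// ltW.
  have -> : s + eps = ((s + eps) `^ (p - 1)^-1) `^ (p - 1).
    by rewrite -powRrM mulVf// powRr1.
  apply: ge0_ler_powR; rewrite ?nnegrE ?powR_ge0 ?(ltW q0)//; first by lra.
  by have := key eps e0; lra.
have -> : delta t = (delta t `^ (p - 1)^-1) `^ (p - 1).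
  by rewrite -powRrM mulVf// powRr1.
apply: ge0_ler_powR; [lra|exact: powR_ge0| |exact: ka].
by rewrite nnegrE addr_ge0 ?powR_ge0.
Qed.

(** The explicit flow belongs to the set under the infimum, and each maximal solution in that set
    dominates it. *)
Lemma Gamma_Gpow (R : realType) (p s r : R) :
  2 < p -> 0 <= s -> 0 <= r ->
  Gamma (Gpow p) r s = (power_flow p s r)%:E.
Proof.
move=> p2 s0 r0.
have rr : r \in `[0, r] by rewrite in_itv/= r0 lexx.
apply/eqP; rewrite eq_le; apply/andP; split.
  apply: ereal_inf_lbound; exists (power_flow p s) => //.
  by split; [exact: power_flow_solution|move=> ?; exact: power_flow_maximal].
apply: le_ereal_inf_tmp => _ [g [_ gmax] <-].
by rewrite lee_fin; apply: gmax => //; exact: power_flow_solution.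
Qed.

(** * Bounds on the averaged growth and on the constant K *)

Lemma Gbar_Gpow_le (R : realType) (p s r : R) :
  2 < p -> 0 <= s -> 0 <= r ->
  (Gbar (Gpow p) r s <= (2 * ((p - 1) * (s `^ (p - 1)^-1 + r) `^ (p - 2)))%:E)%E.
Proof.
move=> p2 s0 r0; have p10 : p - 1 != 0 by lra.
rewrite /Gbar [leRHS]EFinM; apply: lee_wpmul2l => //.
have sa0 := powR_ge0 s (p - 1)^-1.
have GE t : t \in `[0%R, 1%R]%classic ->
    ((1 - t)%:E * er_map (Gpow p) (Gamma (Gpow p) (t * r) s) =
     ((1 - t) * ((p - 1) * (s `^ (p - 1)^-1 + t * r) `^ (p - 2)))%:E)%E.
  rewrite inE/= in_itv/= => /andP[t0 _].
  rewrite Gamma_Gpow ?mulr_ge0//= /Gpow /power_flow -powRrM -EFinM.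
  by congr ((_ * (_ * _ `^ _))%:E); field.
under eq_integral => t tin do rewrite (GE t tin).
(* Crude bounds 1 - t <= 1 and t r <= r make the integrand constant; only a factor 2 is lost from
   the weight. *)
apply: (@le_trans _ _ (\int[lebesgue_measure]_(t in `[0%R, 1%R])
    (cst ((p - 1) * (s `^ (p - 1)^-1 + r) `^ (p - 2))%:E t))%E).
  apply: ge0_le_integral => //.
  - move=> t /=; rewrite in_itv/= => /andP[t0 t1].
    rewrite lee_fin; apply: mulr_ge0; first by lra.
    by apply: mulr_ge0; [lra|exact: powR_ge0].
  - apply/measurable_EFinP; apply: measurable_funTS.
    apply: measurable_funM; first exact: measurable_funB.
    apply: measurable_funM => //.
    apply: (@measurableT_comp _ _ _ _ _ _ (fun u : R => u `^ (p - 2))).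
      exact: measurable_powR.
    by apply: measurable_funD => //; exact: measurable_funM.
  - move=> t /=; rewrite in_itv/= => /andP[t0 t1].
    rewrite lee_fin; apply: (@le_trans _ _ (1 * ((p - 1) * (s `^ (p - 1)^-1 + t * r) `^ (p - 2)))).
      apply: ler_wpM2r; last by lra.
      by apply: mulr_ge0; [lra|exact: powR_ge0].
    rewrite mul1r ler_wpM2l//; first by lra.
    apply: ge0_ler_powR; first by lra.
    + by rewrite nnegrE addr_ge0// mulr_ge0.
    + by rewrite nnegrE addr_ge0.
    + by rewrite lerD2l ler_piMl.
by rewrite integral_cst//= lebesgue_measure_itv/= lte01 oppr0 adde0 mule1.
Qed.

(* With tau = ((p - 1) d)^(1/p) and y = s^(1/(p-1)) / tau, the inequality behind
   K <= 1/4 becomes c eta^2 (y + 1)^(p-2) <= (1 + eta y^(p-1)) / 4. *)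
Lemma rescaled_bound (R : realType) (p c eta y : R) :
  2 < p -> 0 < c -> 0 < eta -> eta <= 1 -> 0 <= y ->
  4 * c * 2 `^ (p - 2) * eta <= 1 ->
  c * eta ^+ 2 * (y + 1) `^ (p - 2) <= 1 / 4 * (1 + eta * y `^ (p - 1)).
Proof.
move=> p2 c0 eta0 eta1 y0 small.
have p20 : 0 <= p - 2 by lra.
have ce0 : 0 < c * eta ^+ 2 by rewrite mulr_gt0// exprn_gt0.
have E : c * eta ^+ 2 * 2 `^ (p - 2) <= 1 / 4 * eta.
  by have := ler_wpM2r (ltW eta0) small; lra.
have Y0 : 0 <= eta * y `^ (p - 1) by rewrite mulr_ge0 ?powR_ge0 ?ltW.
(* For y <= 1 use y + 1 <= 2 and the constant term on the right. For y > 1 use y + 1 <= 2 y and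
   y^(p-2) <= y^(p-1), which the second term absorbs. *)
have [y1|y1] := lerP y 1.
  apply: (@le_trans _ _ (c * eta ^+ 2 * 2 `^ (p - 2))); last by lra.
  by rewrite ler_pM2l//; apply: ge0_ler_powR; rewrite ?nnegrE//; lra.
have y12 : (y + 1) `^ (p - 2) <= 2 `^ (p - 2) * y `^ (p - 1).
  apply: (@le_trans _ _ ((2 * y) `^ (p - 2))).
    by apply: ge0_ler_powR; rewrite ?nnegrE//; lra.
  rewrite powRM// ler_wpM2l ?powR_ge0//.
  by apply: ler_powR; lra.
apply: (@le_trans _ _ (c * eta ^+ 2 * (2 `^ (p - 2) * y `^ (p - 1)))).
  by rewrite ler_pM2l.
rewrite mulrA; apply: (@le_trans _ _ (1 / 4 * eta * y `^ (p - 1))); last by lra.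
by rewrite ler_wpM2r ?powR_ge0.
Qed.

(** In units of tau, sigma = eta tau^(-(p-1)) and r^2 (p - 1) = c eta^2 tau^(-(p-2)). Since r <=
    tau, the base s^(1/(p-1)) + r is at most tau (y + 1); the powers of tau cancel and
    [rescaled_bound] applies. *)
Lemma scaled_curvature_bound (R : realType) (p c eta s sigma r : R) (d : nat) :
  2 < p -> 1 < c -> 0 < eta -> (1 <= d)%N -> 0 <= s ->
  4 * c * 2 `^ (p - 2) * eta <= 1 ->
  sigma = sigma_scale p eta d -> r = sigma * Num.sqrt (c * d%:R) ->
  r ^+ 2 * (p - 1) * (s `^ (p - 1)^-1 + r) `^ (p - 2) <=
    1 / 4 * (1 + sigma * s).
Proof.
move=> p2 c1 eta0 d1 s0 small sigmaE rE.
have c0 : 0 < c by lra.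
have p20 : 0 <= p - 2 by lra.
have p10 : p - 1 != 0 by lra.
have p0 : p != 0 by lra.
have d1' : 1 <= d%:R :> R by rewrite ler1n.
set D := (p - 1) * d%:R.
have D1 : 1 <= D by rewrite /D; nra.
have D0 : 0 <= D by lra.
pose tau := D `^ p^-1.
have tau0 : 0 < tau by rewrite powR_gt0//; lra.
have tau1 : 1 <= tau.
  have : (1 : R) `^ p^-1 <= tau.
    by apply: ge0_ler_powR; rewrite ?nnegrE ?invr_ge0//; lra.
  by rewrite powR1.
have tauN0 : tau != 0 by rewrite gt_eqF.
have tauX u v : tau `^ (u + v) = tau `^ u * tau `^ v.
  by rewrite powRD// tauN0 implybT.
have DE : D = tau ^+ 2 * tau `^ (p - 2).
  rewrite -powR_mulrn ?ltW// -tauX -powRrM.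
  by rewrite (_ : p^-1 * _ = 1) ?powRr1//; field.
have sE : sigma = eta * (tau `^ (p - 1))^-1.
  rewrite sigmaE /sigma_scale -/D -powRN -powRrM; congr (_ * _ `^ _).
  by field.
have tp1 : tau `^ (p - 1) = tau * tau `^ (p - 2).
  by rewrite -[X in _ = X * _](powRr1 (ltW tau0)) -tauX; congr (_ `^ _); ring.
have tp2 : 0 < tau `^ (p - 2) by exact: powR_gt0.
have tp21 : 1 <= tau `^ (p - 2).
  have : (1 : R) `^ (p - 2) <= tau `^ (p - 2).
    by apply: ge0_ler_powR; rewrite ?nnegrE//; lra.
  by rewrite powR1.
have cd0 : 0 <= c * d%:R by nra.
have sigma0 : 0 < sigma by rewrite sigmaE; exact: sigma_scale_gt0.
have r2 : r ^+ 2 = sigma ^+ 2 * (c * d%:R).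
  by rewrite rE exprMn sqr_sqrtr.
have r0 : 0 <= r by rewrite rE mulr_ge0 ?sqrtr_ge0 ?ltW.
have r2p : r ^+ 2 * (p - 1) = c * eta ^+ 2 / tau `^ (p - 2).
  have -> : r ^+ 2 * (p - 1) = sigma ^+ 2 * c * D by rewrite r2 /D; ring.
  rewrite sE tp1 [X in _ * X = _]DE; field.
  by rewrite tauN0 gt_eqF.
have pow1 : 1 <= 2 `^ (p - 2) :> R.
  have : (1 : R) `^ (p - 2) <= 2 `^ (p - 2).
    by apply: ge0_ler_powR; rewrite ?nnegrE//; lra.
  by rewrite powR1.
have ce : c * eta <= 1.
  have : c * eta <= c * eta * 2 `^ (p - 2) by rewrite ler_peMr// mulr_ge0// ltW.
  have : 0 <= c * eta by rewrite mulr_ge0// ltW.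
  by move: small; lra.
have eta1 : eta <= 1 by nra.
have ce2 : c * eta ^+ 2 <= 1 by rewrite expr2; nra.
(* In fact r <= 1 <= tau, because r^2 <= r^2 (p - 1) <= c eta^2 <= 1. *)
have rtau : r <= tau.
  suff : r ^+ 2 <= 1 by move=> h; nra.
  have : r ^+ 2 * (p - 1) <= 1.
    by rewrite r2p ler_pdivrMr// mul1r; lra.
  by have := sqr_ge0 r; nra.
set u := s `^ (p - 1)^-1; have u0 : 0 <= u by exact: powR_ge0.
have ss : s = u `^ (p - 1) by rewrite -powRrM mulVf// powRr1.
pose y := u / tau; have y0 : 0 <= y by rewrite divr_ge0// ltW.
have uE : u = tau * y by rewrite /y; field.
have -> : sigma * s = eta * y `^ (p - 1).
  rewrite ss sE uE powRM// ?ltW//; field.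
  by rewrite gt_eqF// powR_gt0.
apply: le_trans (rescaled_bound p2 c0 eta0 eta1 y0 small).
rewrite r2p.
apply: (@le_trans _ _ (c * eta ^+ 2 / tau `^ (p - 2) * (tau * (y + 1)) `^ (p - 2))).
  rewrite ler_wpM2l//.
    by rewrite divr_ge0 ?powR_ge0// mulr_ge0 ?sqr_ge0// ltW.
  have -> : tau * (y + 1) = u + tau by rewrite uE; ring.
  have ut0 : 0 <= tau by exact: ltW.
  by apply: ge0_ler_powR p20 _ _ _ _ _; rewrite ?nnegrE ?addr_ge0 ?lerD2l.
rewrite powRM; [|exact: ltW|by rewrite addr_ge0].
rewrite le_eqVlt; apply/orP; left; apply/eqP; field.
by rewrite gt_eqF.
Qed.

Lemma calKc_Gpow_le (R : realType) (p c eta : R) (d : nat) :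
  2 < p -> 1 < c -> 0 < eta -> (1 <= d)%N ->
  4 * c * 2 `^ (p - 2) * eta <= 1 ->
  (calKc c d (sigma_scale p eta d) (Gpow p) <= (1 / 4)%:E)%E.
Proof.
move=> p2 c1 eta0 d1 small.
have sigma0 := sigma_scale_gt0 p2 eta0 d1.
have bound s : 0 <= s -> _ := fun s0 =>
  scaled_curvature_bound p2 c1 eta0 d1 s0 small erefl erefl.
rewrite /calKc /calK; set sigma := sigma_scale p eta d in sigma0 bound *.
set r := sigma * _ in bound *.
have r0 : 0 < r.
  rewrite mulr_gt0// sqrtr_gt0 mulr_gt0 ?ltr0n//; lra.
have r20 : 0 < r ^+ 2 / 2 by rewrite divr_gt0// exprn_gt0.
have -> : ((1 / 4)%:E = (r ^+ 2 / 2)%:E * ((1 / 4) / (r ^+ 2 / 2))%:E :> \bar R)%E.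
  by rewrite -EFinM; congr (_%:E); field; rewrite gt_eqF.
apply: lee_wpmul2l; first by rewrite lee_fin ltW.
apply: ge_ereal_sup => _ [s /= s0 <-].
have ss0 : 0 < 1 + sigma * s by rewrite ltr_pwDl// mulr_ge0// ltW.
apply: (@le_trans _ _ ((2 * ((p - 1) * (s `^ (p - 1)^-1 + r) `^ (p - 2)))%:E *
    (1 + sigma * s)^-1%:E)%E).
  apply: lee_wpmul2r; first by rewrite lee_fin invr_ge0 ltW.
  by apply: Gbar_Gpow_le => //; exact: ltW.
rewrite -EFinM lee_fin ler_pdivrMr// mulrAC ler_pdivlMr//.
by have := bound s s0; lra.
Qed.

(** * Gradient and Hessian *)

Lemma derive_scalar_comp (R : realType) (V : normedModType R) (g : V -> R)
  (f : R -> R) (x v : V) (df : R) :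
  differentiable g x -> is_derive (g x) 1 f df ->
  differentiable (f \o g) x /\ 'D_v (f \o g) x = df * 'D_v g x.
Proof.
move=> dg [fd fE].
have df' : differentiable f (g x) by exact/derivable1_diffP.
have dfg : differentiable (f \o g) x by exact: differentiable_comp.
split=> //; rewrite !deriveE// diff_comp//= diff1E//= derive1E fE.
by rewrite mulrC.
Qed.

Lemma is_diff_null (R : realType) (V W : normedModType R)
  (f : V -> W) (k : V -> R) : f 0 = 0 -> (forall h, `|f h| <= k h * `|h|) ->
  k h @[h --> (0 : V)] --> (0 : R) -> is_diff (0 : V) f (\0 : V -> W).
Proof.
move=> f0 fk k0.
have c0 : continuous (\0 : {linear V -> W}) by move=> x; exact: cvg_cst.
have E : f \o shift (0 : V) = cst (f 0) + (\0 : {linear V -> W}) +o_ (0 : V) id.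
  apply/eqaddoP => e e0; near=> h.
  rewrite f0 !fctE/= addr0 addr0 subr0.
  apply: (le_trans (fk h)); rewrite ler_wpM2r//.
  apply: le_trans (ler_norm _) _; near: h.
  move/cvgrPdist_le : k0 => /(_ e e0); apply: filterS => h.
  by rewrite sub0r normrN.
have d0 := diff_unique c0 E.
by split=> //; apply/diff_locallyP; rewrite d0.
Unshelve. all: by end_near. Qed.

Section power_potential.
Context {R : realType} {d : nat}.
Implicit Types (x v : 'rV[R]_d) (p : R).

Lemma derive_coord x v (j : 'I_d) :
  'D_v (fun y : 'rV[R]_d => y ord0 j) x = v ord0 j.
Proof.
have := derive_mx (@derivable_id _ _ x v); rewrite derive_id => /matrixP/(_ ord0 j).
by rewrite mxE.
Qed.

Let dotE : (fun y : 'rV[R]_d => dot y y) =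
  \sum_(i < d) ((fun y : 'rV[R]_d => y ord0 i) * (fun y => y ord0 i)).
Proof. by apply/funext => y; rewrite fct_sumE. Qed.

Lemma differentiable_dot x : differentiable (fun y : 'rV[R]_d => dot y y) x.
Proof.
rewrite dotE; apply: differentiable_sum => i.
by apply: differentiableM; exact: differentiable_coord.
Qed.

Lemma derive_dot x v : 'D_v (fun y : 'rV[R]_d => dot y y) x = 2 * dot x v.
Proof.
have dc i : derivable (fun y : 'rV[R]_d => y ord0 i) x v.
  by apply: diff_derivable; exact: differentiable_coord.
rewrite dotE derive_sum; last by move=> i; exact: derivableM.
rewrite mulr_sumr; apply: eq_bigr => i _.
by rewrite deriveM// derive_coord/= /GRing.scale/=; ring.
Qed.

(** With the absolute value the derivative at 0 is two-sided; it vanishes there because q > 1, in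
    agreement with 0^(q-1) = 0. *)
Lemma is_derive_norm_powR (q s : R) : 1 < q -> 0 <= s ->
  is_derive s 1 (fun u : R => `|u| `^ q) (q * s `^ (q - 1)).
Proof.
move=> q1; rewrite le_eqVlt => /predU1P[<-|s0].
  have [f0 f'0] : is_diff (0 : R) (fun u : R => `|u| `^ q) (\0 : R -> R).
    apply: (@is_diff_null _ _ _ _ (fun u => `|u| `^ (q - 1))).
    - by rewrite normr0 powR0//; lra.
    - by move=> h; rewrite ger0_norm ?powR_ge0// mulrC mulr_powRB1//; lra.
    - have := @continuous_norm_powR R (q - 1) _ 0.
      by rewrite /continuous_at normr0 powR0; [apply; lra|lra].
  rewrite powR0; last by lra.
  rewrite mulr0; split; first exact/derivable1_diffP.
  by rewrite deriveE// f'0.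
apply: (@near_eq_is_derive _ _ _ (fun u : R => u `^ q)); last exact: is_derive1_powR.
near=> u; rewrite ger0_norm//; near: u.
by near=> u; apply: ltW; near: u; exact: lt_nbhsr.
Unshelve. all: by end_near. Qed.

Lemma UpowE p x : Upow p x = p^-1 * `|dot x x| `^ (p / 2).
Proof. by rewrite /Upow powR_enorm ger0_norm ?dot_ge0. Qed.

Lemma Upow_diff p x : 2 < p -> differentiable (@Upow R p d) x /\
  forall v, 'D_v (@Upow R p d) x = enorm x `^ (p - 2) * dot x v.
Proof.
move=> p2; have p0 : p != 0 by lra.
have -> : @Upow R p d = p^-1 \*:
    ((fun u : R => `|u| `^ (p / 2)) \o (fun y : 'rV[R]_d => dot y y)).
  by apply/funext => y; rewrite UpowE.
have q1 : 1 < p / 2 by lra.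
have D v := derive_scalar_comp v (differentiable_dot x)
  (is_derive_norm_powR q1 (dot_ge0 x)).
split=> [|v]; first by apply: differentiableZ; exact: (D 0).1.
rewrite deriveZ; last by apply: diff_derivable; exact: (D 0).1.
rewrite (D v).2 derive_dot powR_enorm (_ : (p - 2) / 2 = p / 2 - 1); last by field.
by rewrite /GRing.scale/=; field.
Qed.

Lemma gradient_Upow p : 2 < p ->
  gradient (@Upow R p d) = fun x => enorm x `^ (p - 2) *: x.
Proof.
move=> p2; apply/funext => x; apply/rowP => j.
rewrite !mxE (Upow_diff x p2).2; congr (_ * _).
rewrite /dot (bigD1 j)//= mxE !eqxx mulr1 big1 ?addr0// => i /negbTE ij.
by rewrite mxE ij andbF mulr0.
Qed.

Lemma enorm_gradient_Upow p x : 2 < p ->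
  enorm (gradient (@Upow R p d) x) = enorm x `^ (p - 1).
Proof.
move=> p2; rewrite gradient_Upow// enormZ ger0_norm ?powR_ge0// mulrC.
rewrite (_ : p - 2 = (p - 1) - 1); last by ring.
by rewrite mulr_powRB1 ?enorm_ge0//; lra.
Qed.

(** The origin is separate: the exponent (p - 2) / 2 of [dot x x] may be at most 1, so the chain
    rule can fail, but the factor |x|^(p-2) tends to 0. *)
Lemma gradient_Upow_diff0 p : 2 < p ->
  is_diff (0 : 'rV[R]_d) (fun x => enorm x `^ (p - 2) *: x)
    (\0 : 'rV[R]_d -> 'rV[R]_d).
Proof.
move=> p2.
apply: (@is_diff_null _ _ _ _ (fun x => enorm x `^ (p - 2))).
- by rewrite scaler0.
- by move=> h; rewrite normrZ ger0_norm ?powR_ge0.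
under eq_fun do rewrite powR_enorm -[dot _ _]ger0_norm ?dot_ge0//.
have p20 : 0 < (p - 2) / 2 by lra.
have c : {for 0, continuous ((fun u : R => `|u| `^ ((p - 2) / 2)) \o
    (fun y : 'rV[R]_d => dot y y))}.
  apply: continuous_comp; last exact: continuous_norm_powR.
  exact: differentiable_continuous (differentiable_dot 0).
move: c; rewrite /prop_for /continuous_at /= -enorm_sqr enorm0 expr0n normr0 powR0//.
by rewrite gt_eqF.
Qed.

Lemma gradient_Upow_diff p x : 2 < p -> x != 0 ->
  differentiable (fun x => enorm x `^ (p - 2) *: x) x /\
  forall v, 'D_v (fun x => enorm x `^ (p - 2) *: x) x =
    enorm x `^ (p - 2) *: v + ((p - 2) * enorm x `^ (p - 4) * dot x v) *: x.
Proof.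
move=> p2 x0.
have xx : 0 < dot x x by rewrite -enorm_sqr exprn_gt0// enorm_gt0.
pose k := (fun u : R => u `^ ((p - 2) / 2)) \o (fun y : 'rV[R]_d => dot y y).
have kE y : enorm y `^ (p - 2) = k y by rewrite powR_enorm.
have D v := derive_scalar_comp v (differentiable_dot x)
  (is_derive1_powR ((p - 2) / 2) xx).
have dk : differentiable k x := (D 0).1.
(* Split along the basis, the field becomes a sum of scalar functions times fixed vectors, so the
   scalar rules give differentiability. *)
have FE : (fun x => enorm x `^ (p - 2) *: x) =
    \sum_(j < d) (fun y => (k y * y ord0 j) *: delta_mx ord0 j).
  apply/funext => y; rewrite fct_sumE kE [X in _ *: X]row_sum_delta scaler_sumr.
  by apply: eq_bigr => j _; rewrite scalerA.
have dF : differentiable (fun x => enorm x `^ (p - 2) *: x) x.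
  rewrite FE; apply: differentiable_sum => j; apply: differentiableZl.
  by apply: differentiableM => //; exact: differentiable_coord.
split=> // v; rewrite derive_mx; last exact: diff_derivable.
apply/rowP => j; rewrite !mxE.
under eq_fun do rewrite mxE kE.
rewrite deriveM; [|exact: diff_derivable|]; last first.
  by apply: diff_derivable; exact: differentiable_coord.
rewrite derive_coord (D v).2 derive_dot /GRing.scale/= kE.
rewrite powR_enorm (_ : (p - 4) / 2 = (p - 2) / 2 - 1); last by field.
by rewrite /k/=; field.
Qed.

Lemma opnormE (A : 'M[R]_d) (m : R) : 0 <= m ->
  (forall v, enorm (v *m A) <= m * enorm v) ->
  (exists2 v, enorm v <= 1 & enorm (v *m A) = m) -> opnorm A = m.
Proof.
move=> m0 ub [v v1 vm]; apply/eqP; rewrite eq_le; apply/andP; split.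
  apply: ge_sup; first by exists m, v.
  move=> _ [w /= w1 <-]; apply: (le_trans (ub w)).
  by rewrite ler_piMr.
apply: ub_le_sup; last by exists v.
exists m => _ [w /= w1 <-]; apply: (le_trans (ub w)).
by rewrite ler_piMr.
Qed.

(** Away from 0 the Hessian is a I + b x^T x with a, b >= 0. Squaring and Cauchy-Schwarz bound its
    norm by a + b |x|^2 = (p - 1) |x|^(p-2), attained at x / |x|. At 0 both sides vanish, as p >
    2. *)
Lemma opnorm_hessian_Upow p x : 2 < p -> (1 <= d)%N ->
  opnorm (hessian (@Upow R p d) x) = (p - 1) * enorm x `^ (p - 2).
Proof.
move=> p2 d1; rewrite /hessian gradient_Upow//.
have [->|x0] := eqVneq x 0.
  have [F0 F0E] := gradient_Upow_diff0 p2.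
  have H0 v : v *m jacobian (fun x => enorm x `^ (p - 2) *: x) 0 = 0.
    by rewrite -deriveEjacobian// deriveE// F0E.
  rewrite enorm0 powR0; last by lra.
  rewrite mulr0; apply: opnormE => //.
    by move=> v; rewrite H0 enorm0 mul0r.
  by exists 0; rewrite ?H0 enorm0.
have [dF FE] := gradient_Upow_diff p2 x0.
have ex0 : 0 < enorm x by rewrite enorm_gt0.
set e := enorm x in ex0 *.
have e0 : e != 0 by rewrite gt_eqF.
set a := e `^ (p - 2); set b := (p - 2) * e `^ (p - 4).
have a0 : 0 <= a by exact: powR_ge0.
have b0 : 0 <= b by rewrite mulr_ge0 ?powR_ge0//; lra.
have ab : a + b * e ^+ 2 = (p - 1) * a.
  have -> : a = e `^ (p - 4) * e ^+ 2.
    rewrite -powR_mulrn ?ltW// -powRD; first by congr (_ `^ _); ring.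
    by apply/implyP.
  by rewrite /b; ring.
rewrite -ab; have m0 : 0 <= a + b * e ^+ 2.
  by rewrite addr_ge0// mulr_ge0// sqr_ge0.
apply: opnormE => //.
- move=> v; rewrite -deriveEjacobian// FE -/e -/a -/b.
  rewrite -(ler_pXn2r (n := 2)) ?nnegrE ?mulr_ge0 ?enorm_ge0//.
  rewrite enorm_sqrD !enormZ !exprMn dotZl dotZr !real_normK ?num_real//.
  rewrite -/e (dotC v x) exprMn.
  have cs := dot_sqr_le x v; rewrite -/e in cs.
  set c := dot x v in cs *; set V := enorm v ^+ 2 in cs *.
  have h1 : 2 * (a * b) * c ^+ 2 <= 2 * (a * b) * (e ^+ 2 * V).
    by rewrite ler_wpM2l// mulr_ge0// mulr_ge0.
  have h2 : b ^+ 2 * e ^+ 2 * c ^+ 2 <= b ^+ 2 * e ^+ 2 * (e ^+ 2 * V).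
    by rewrite ler_wpM2l// mulr_ge0// sqr_ge0.
  by move: h1 h2; lra.
- exists (e^-1 *: x).
    by rewrite enormZ -/e gtr0_norm ?invr_gt0// mulVf.
  rewrite -deriveEjacobian// FE -/e -/a -/b dotZr -enorm_sqr -/e.
  have -> : a *: (e^-1 *: x) + (b * (e^-1 * e ^+ 2)) *: x =
      ((a + b * e ^+ 2) / e) *: x.
    by rewrite scalerA -scalerDl; congr (_ *: _); field.
  by rewrite enormZ -/e ger0_norm ?divfK// divr_ge0// ltW.
Qed.

End power_potential.

Theorem mainTheorem2 (R : realType) (p : R) (hp : 2 < p) :
  (forall (d : nat), (1 <= d)%N -> forall x : 'rV[R]_d,
     [/\ differentiable (@Upow R p d) x,
         differentiable (gradient (@Upow R p d)) x &
         opnorm (hessian (@Upow R p d) x) =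
           (p - 1) * enorm (gradient (@Upow R p d) x) `^ ((p - 2) / (p - 1))])
  /\
  (forall c : R, 1 < c ->
     exists eta0 : R, 0 < eta0 /\
       forall eta : R, 0 < eta -> eta <= eta0 ->
         (forall d : nat, (1 <= d)%N ->
            (calKc c d (sigma_scale p eta d) (Gpow p) <= (1 / 4)%:E)%E) /\
         (0 < ereal_inf [set alpha_inf (@Upow R p d) (sigma_scale p eta d)
                        | d in [set d : nat | (1 <= d)%N]])%E).
Proof.
split=> [d d1 x|c c1].
  split; first exact: (Upow_diff x hp).1.
    rewrite gradient_Upow//; have [->|x0] := eqVneq x 0.
      exact: (gradient_Upow_diff0 hp).(ex_diff).
    exact: (gradient_Upow_diff hp x0).1.
  rewrite opnorm_hessian_Upow// enorm_gradient_Upow// -powRrM.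
  by congr (_ * _ `^ _); field; lra.
have C0 : 0 < 4 * c * 2 `^ (p - 2) by rewrite !mulr_gt0 ?powR_gt0//; lra.
(* The threshold turns eta <= eta0 into the smallness condition of [calKc_Gpow_le]. *)
exists (4 * c * 2 `^ (p - 2))^-1; split; first by rewrite invr_gt0.
move=> eta eta0 small; split=> [d d1|].
  by apply: calKc_Gpow_le; rewrite // mulrC -ler_pdivlMr// div1r.
have [k [k0 kalpha]] := alpha_Upow_ge hp eta0.
apply: (@lt_le_trans _ _ k%:E); first by rewrite lte_fin.
apply: le_ereal_inf_tmp => _ [d /= d1 <-].
by apply: le_ereal_inf_tmp => _ [x _ <-]; exact: kalpha.
Qed.
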